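(* Let $R$ be a non-associative ring and let $\sigma,\delta:R\to R$ be additive maps with $\sigma(1)=1$ and $\delta(1)=0$. Then the generalized polynomial ring $S = R[X;\sigma,\delta]$ is a non-associative Ore extension of $R$ with $x = X$ (that is, $(S,X)$ is a non-associative Ore extension of $R$). If moreover $\sigma$ is a fixed point homomorphism and $\delta$ is a $\sigma$-kernel derivation, then $(S,X)$ is a strong non-associative Ore extension of $R$.
   Context: A non-associative ring is an additive abelian group with a (not necessarily associative) multiplication that is left and right distributive, and with a multiplicative identity $1$. For subsets $A,B,C$ of a ring, $(A,B,C)$ denotes the set of finite sums of associators $(a,b,c)=(ab)c-a(bc)$, $a\in A$, $b\in B$, $c\in C$. Generalized polynomial ring: $R[X;\sigma,\delta]$ is the set of formal polynomials $\sum_i r_iX^i$ ($r_i\in R$) with the usual addition and with multiplication the biadditive extension of $aX^m\cdot bX^n=\sum_{i\in\mathbb{N}} a\,\pi_i^m(b)X^{i+n}$, where $\pi_i^m$ is the sum of all $\binom{m}{i}$ possible compositions of $i$ copies of $\sigma$ and $m-i$ copies of $\delta$ in arbitrary order, and $\pi_i^m=0$ if $i>m$. Each $r\in R$ is identified with $rX^0$. Put $R_\delta^\sigma=\{a\in R\mid \sigma(a)=a,\ \delta(a)=0\}$. One says that $\sigma$ is a fixed point homomorphism and $\delta$ is a $\sigma$-kernel derivation if $\sigma(1)=1$, $\delta(1)=0$, and either both maps are right $R_\delta^\sigma$-linear ($\sigma(ra)=\sigma(r)a$, $\delta(ra)=\delta(r)a$ for $r\in R$, $a\in R_\delta^\sigma$)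 or both are left $R_\delta^\sigma$-linear ($\sigma(ar)=a\sigma(r)$, $\delta(ar)=a\delta(r)$). Non-associative Ore extension: let $S$ be a non-associative ring, $x\in S$, and $R$ a subring of $S$ containing $1$. The pair $(S,x)$ is a non-associative Ore extension of $R$ if (N1) $S$ is a free left $R$-module with basis $\{1,x,x^2,\ldots\}$ (every element of $S$ is uniquely a finite sum $\sum_i r_ix^i$ with $r_i\in R$); (N2) $xR\subseteq R+Rx$; (N3) $(S,S,x)=(S,x,S)=\{0\}$. It is strong if, with $R_x=\{a\in R\mid ax=xa\}$, at least one of the following holds: (N4) $(x,R,R_x)=\{0\}$; (N5) $(x,R_x,R)=\{0\}$. *)

(* Defs.v *)
From HB Require Import structures.
From mathcomp Require Import all_boot all_algebra.
From mathcomp Require Import finmap.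
From mathcomp.multinomials Require Import monalg.
From mathcomp.classical Require Import classical_sets.

Set Implicit Arguments.
Unset Strict Implicit.
Unset Printing Implicit Defensive.

Local Open Scope classical_set_scope.
Local Open Scope ring_scope.
(* In this file, 1, * and ^+ in ring_scope are those of the unital magma. *)
Local Notation "1" := (1%g) : ring_scope.
Local Notation "x * y" := (x%R * y%R)%g : ring_scope.
Local Notation "x ^+ n" := (x%R ^+ n)%g : ring_scope.

(* An additive group with a product and a distinguished element 1; no axiom
   relates the product to 1 or to the addition. *)
#[short(type="zmodUMagmaType")]
HB.structure Definition ZmodUMagma := {A of GRing.Zmodule A & BaseUMagma A}.

Definition nonassoc_ring (A : zmodUMagmaType) : Prop :=
  [/\ left_id (1 : A) *%g, right_id (1 : A) *%g,
      left_distributive *%g (@GRing.add A) & right_distributive *%g (@GRing.add A)].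

HB.mixin Record ZmodUMagma_isNaRing A of ZmodUMagma A := {
  nonassoc_ringP : nonassoc_ring A
}.

#[short(type="naRingType")]
HB.structure Definition NaRing := {A of ZmodUMagma A & ZmodUMagma_isNaRing A}.

Section OreExtension.
Context (S : zmodUMagmaType).
Implicit Types (A B C R : set S) (x : S).

Definition associator (a b c : S) : S := (a * b) * c - a * (b * c).

Definition associators A B C : set S :=
  [set s | exists (n : nat) (a b c : 'I_n -> S),
     (forall i, [/\ A (a i), B (b i) & C (c i)]) /\
     s = \sum_(i < n) associator (a i) (b i) (c i)].

Definition is_subring R : Prop :=
  [/\ R 1, forall a b, R a -> R b -> R (a - b)
         & forall a b, R a -> R b -> R (a * b)].

(* {malg S[nat]} is the type of finitely supported families of elements of S
   indexed by nat; r@_i is the entry of index i. *)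
Definition powers_basis R x : Prop :=
  forall s : S, exists! r : {malg S[nat]},
    (forall i, R r@_i) /\ s = \sum_(i <- msupp r) r@_i * x ^+ i.

Definition nonassoc_Ore_extension R x : Prop :=
  [/\ nonassoc_ring S /\ is_subring R,
      powers_basis R x,
      forall a, R a -> exists b c, [/\ R b, R c & x * a = b + c * x]
    & associators setT setT [set x] = [set 0] /\
      associators setT [set x] setT = [set 0]].

Definition strong_nonassoc_Ore_extension R x : Prop :=
  let Rx := [set a | R a /\ a * x = x * a] in
  nonassoc_Ore_extension R x /\
  (associators [set x] R Rx = [set 0] \/ associators [set x] Rx R = [set 0]).

End OreExtension.

(* <<a *g n>> is the monomial a X^n. The maps sigma and delta do not affect the
   set of polynomials; they index the type because its product depends on
   them. *)
Definition gpoly (R : zmodUMagmaType) (sigma delta : {additive R -> R}) : Type :=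
  {malg R[nat]}.

Notation "{ 'gpoly' R ; sigma , delta }" := (@gpoly R sigma delta)
  (at level 0, R, sigma, delta at level 2,
   format "{ 'gpoly'  R ;  sigma ,  delta }") : type_scope.

Section GeneralizedPolynomials.
Context (R : zmodUMagmaType) (sigma delta : {additive R -> R}).

Definition fixed_kernel : set R := [set a | sigma a = a /\ delta a = 0].

Definition fixed_kernel_right_linear (f : R -> R) : Prop :=
  forall r a, fixed_kernel a -> f (r * a) = f r * a.

Definition fixed_kernel_left_linear (f : R -> R) : Prop :=
  forall a r, fixed_kernel a -> f (a * r) = a * f r.

Definition fixed_point_hom_kernel_derivation : Prop :=
  [/\ sigma 1 = 1, delta 1 = 0 &
      (fixed_kernel_right_linear sigma /\ fixed_kernel_right_linear delta) \/
      (fixed_kernel_left_linear sigma /\ fixed_kernel_left_linear delta)].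

(* A word of m booleans encodes a composition of m maps, true standing for
   sigma and false for delta. *)
Definition word_comp (w : seq bool) : R -> R :=
  foldr (fun b f => (if b then sigma else delta) \o f) id w.

Definition ore_pi (m i : nat) (b : R) : R :=
  \sum_(w : m.-tuple bool | count id w == i) word_comp w b.

HB.instance Definition _ := GRing.Zmodule.on {gpoly R; sigma, delta}.

(* The inner sum may stop at i = m since ore_pi m i = 0 for i > m. *)
Definition gpoly_mul (p q : {gpoly R; sigma, delta}) : {gpoly R; sigma, delta} :=
  \sum_(m <- msupp p) \sum_(n <- msupp q) \sum_(i < m.+1)
    << p@_m * ore_pi m i q@_n *g (i + n)%N >>.

Definition gpolyC (r : R) : {gpoly R; sigma, delta} := << r *g 0%N >>.

Definition gpolyX : {gpoly R; sigma, delta} := << 1 *g 1%N >>.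

HB.instance Definition _ := hasMul.Build {gpoly R; sigma, delta} gpoly_mul.
HB.instance Definition _ := hasOne.Build {gpoly R; sigma, delta} (gpolyC 1).

End GeneralizedPolynomials.

(* Main.v *)
Require Import Defs.
From mathcomp Require Import all_boot all_algebra.
From mathcomp Require Import finmap.
From mathcomp.multinomials Require Import monalg.
From mathcomp.classical Require Import classical_sets.

Set Implicit Arguments.
Unset Strict Implicit.
Unset Printing Implicit Defensive.

(** Every identity to be proved in [S = R[X; sigma, delta]] is additive in each
    of its arguments, because the product of [S] is biadditive; so it is enough
    to check it on monomials, where it becomes an identity about the maps
    [ore_pi].

    Two such identities carry everything.  First, since [sigma 1 = 1] and
    [delta 1 = 0], only the word made of copies of sigma alone contributes to
    the value at [1]: [ore_pi m i 1] is [1] for [i = m] and [0] otherwise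
    ([ore_pir1]).  Hence multiplying by [X] on the right only shifts exponents
    ([gpoly_mulU1]), which gives the right identity law, the formula for the
    powers of [X], so that these form a basis, and [(S, S, X) = 0].  Second,
    splitting the words of length [m + 1] according to the map that is applied
    first gives
    [ore_pi m.+1 i = ore_pi m (i - 1) \o sigma + ore_pi m i \o delta],
    where the first term is absent for [i = 0] ([ore_piS]); this is precisely
    what makes [(a X^m X) (b X^n)] and [a X^m (X (b X^n))] equal, that is,
    [(S, X, S) = 0] ([associator_X_mid]).

    For strongness, [X a = sigma(a) X + delta(a)] shows that the constants
    commuting with [X] are the [a] with [sigma a = a] and [delta a = 0].  The
    two coefficients of [(X, a, b)] ([associator_XCC]) measure the failure of
    sigma to be multiplicative and of delta to be a sigma-derivation at
    [(a, b)]; both vanish by right linearity if [b] is such a constant, and by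
    left linearity if [a] is. *)

Import GRing.Theory.

Local Open Scope ring_scope.
Local Notation "1" := (1%g) : ring_scope.
Local Notation "x * y" := (x%R * y%R)%g : ring_scope.
Local Notation "x ^+ n" := (x%R ^+ n)%g : ring_scope.

(** * Additive extension from monomials *)

Section FinitelySupported.
Context (K : choiceType) (G : zmodType).
Implicit Types (g : {malg G[K]}) (k : K).

Lemma malg_ind (P : {malg G[K]} -> Prop) :
  P 0 -> (forall g h, P g -> P h -> P (g + h)) ->
  (forall a k, P << a *g k >>) -> forall g, P g.
Proof. by move=> P0 PD PU g; rewrite [g]monalgE; apply: big_ind. Qed.

Lemma sum_msuppw (H : zmodType) (f : K -> G -> H) g (d : {fset K}) :
  (forall k, f k 0 = 0) -> (msupp g `<=` d)%fset ->
  \sum_(k <- msupp g) f k g@_k = \sum_(k <- d) f k g@_k.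
Proof.
move=> f0 le_gd; apply: big_fset_incl => // k _ /mcoeff_outdom ->.
exact: f0.
Qed.

Lemma sum_msuppU (H : zmodType) (f : K -> G -> H) a k :
  (forall k, f k 0 = 0) ->
  \sum_(j <- msupp << a *g k >>) f j << a *g k >>@_j = f k a.
Proof.
by move=> f0; rewrite (sum_msuppw f0 msuppU_le) big_seq_fset1 mcoeffUU.
Qed.

(** The support of [g + h] may be smaller than the union of the supports, so the
    three sums are first extended to that union. *)
Lemma sum_msuppD (H : zmodType) (f : K -> G -> H) g h :
  (forall k, {morph f k : a b / a + b}) ->
  \sum_(k <- msupp (g + h)) f k (g + h)@_k =
  \sum_(k <- msupp g) f k g@_k + \sum_(k <- msupp h) f k h@_k.
Proof.
move=> fD; have f0 k : f k 0 = 0 by apply: (addIr (f k 0)); rewrite -fD !add0r.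
rewrite (sum_msuppw f0 (msuppD_le g h)).
rewrite (sum_msuppw f0 (fsubsetUl (msupp g) (msupp h))).
rewrite (sum_msuppw f0 (fsubsetUr (msupp g) (msupp h))).
by rewrite -big_split; apply: eq_bigr => k _; rewrite mcoeffD fD.
Qed.

Lemma mcoeff_sumU (H : zmodType) (f : G -> H) g k :
  f 0 = 0 -> (\sum_(j <- msupp g) << f g@_j *g j >>)@_k = f g@_k.
Proof.
move=> f0.
rewrite (sum_msuppw (f := fun j a => << f a *g j >>)
                    (d := (k |` msupp g)%fset)) ?fsubsetU1 //; last first.
  by move=> j; rewrite f0 monalgU0.
rewrite raddf_sum (big_fsetD1 k) ?fset1U1 //= mcoeffUU big1_fset ?addr0 // => j.
by rewrite in_fsetD1 mcoeffU; case: eqP.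
Qed.

End FinitelySupported.

(** * Associators in a non-associative ring *)

Section NonassocRing.
Context (S : zmodUMagmaType) (S_ring : nonassoc_ring S).
Implicit Types (a b c : S).

Lemma na_mul1r a : 1 * a = a. Proof. by case: S_ring => ->. Qed.
Lemma na_mulr1 a : a * 1 = a. Proof. by case: S_ring => _ ->. Qed.
Lemma na_mulDl a b c : (a + b) * c = a * c + b * c.
Proof. by case: S_ring => _ _ ->. Qed.
Lemma na_mulDr a b c : a * (b + c) = a * b + a * c.
Proof. by case: S_ring => _ _ _ ->. Qed.
Lemma na_mul0r a : 0 * a = 0.
Proof. by apply: (addIr (0 * a)); rewrite -na_mulDl !add0r. Qed.
Lemma na_mulr0 a : a * 0 = 0.
Proof. by apply: (addIr (a * 0)); rewrite -na_mulDr !add0r. Qed.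
Lemma na_mulr_suml I (r : seq I) (F : I -> S) a :
  (\sum_(i <- r) F i) * a = \sum_(i <- r) F i * a.
Proof.
by apply: (big_morph (fun x => x * a)) => [x y|]; rewrite ?na_mulDl ?na_mul0r.
Qed.

Lemma associatorDl a a' b c :
  associator (a + a') b c = associator a b c + associator a' b c.
Proof. by rewrite /associator !na_mulDl opprD addrACA. Qed.
Lemma associatorDm a b b' c :
  associator a (b + b') c = associator a b c + associator a b' c.
Proof. by rewrite /associator !(na_mulDl, na_mulDr) opprD addrACA. Qed.
Lemma associatorDr a b c c' :
  associator a b (c + c') = associator a b c + associator a b c'.
Proof. by rewrite /associator !na_mulDr opprD addrACA. Qed.
End NonassocRing.

(** The empty sum is a sum of associators, so the set on the left contains [0]
    even when [A], [B] or [C] is empty. *)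
Lemma associators_eq0 (S : zmodUMagmaType) (A B C : set S) :
  (forall a b c, A a -> B b -> C c -> associator a b c = 0) ->
  associators A B C = [set 0]%classic.
Proof.
move=> ABC0; apply/seteqP; split=> [s [n [a [b [c [abcP ->]]]]]|s ->] /=.
  by apply: big1 => i _; have [] := abcP i; apply: ABC0.
by exists 0%N; do 3!exists (fun=> 0); split=> [[]|]; rewrite ?big_ord0.
Qed.

(** * Words in sigma and delta *)

Section OrePi.
Context (R : naRingType) (sigma delta : {additive R -> R}).
Implicit Types (a b r : R) (m n i : nat).

Local Notation wc := (word_comp sigma delta).
Local Notation pi := (ore_pi sigma delta).

Lemma word_compD w : {morph wc w : a b / a + b}.
Proof. by elim: w => //= c w IH a b; case: c; rewrite /= IH raddfD. Qed.

Lemma word_comp_rcons w (c : bool) b :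
  wc (rcons w c) b = wc w ((if c then sigma else delta) b).
Proof. by elim: w => //= d w ->. Qed.

Lemma ore_piD m i : {morph pi m i : a b / a + b}.
Proof.
by move=> a b; rewrite -big_split; apply: eq_bigr => w _; apply: word_compD.
Qed.

Lemma ore_pi0r m i : pi m i 0 = 0.
Proof. by apply: (addIr (pi m i 0)); rewrite -ore_piD !add0r. Qed.

Lemma ore_pi_gt m i b : (m < i)%N -> pi m i b = 0.
Proof.
move=> lt_mi; apply: big_pred0 => w; apply: contraTF lt_mi => /eqP <-.
by rewrite -leqNgt -[leqRHS](size_tuple w) count_size.
Qed.

Lemma ore_pi00 b : pi 0 0 b = b.
Proof.
rewrite /ore_pi (big_pred1 [tuple]) // => w.
by rewrite [w]tuple0; apply/esym/eqxx.
Qed.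

(** The last letter of a word stands for the map that is applied first; the
    words of length [m + 1] are split according to it. *)
Lemma ore_piS m i b :
  pi m.+1 i b = (if i is j.+1 then pi m j (sigma b) else 0) + pi m i (delta b).
Proof.
pose app_last (p : bool * m.-tuple bool) := [tuple of rcons p.2 p.1].
have app_inj : injective app_last.
  by move=> [c v] [d w] /(congr1 val)/rcons_inj[/val_inj-> ->].
have app_bij : bijective app_last.
  apply: (inj_card_bij app_inj).
  by rewrite card_prod !card_tuple card_bool expnS.
transitivity (\sum_(c : bool) \sum_(w : m.-tuple bool | (count id w + c == i)%N)
    wc w ((if c then sigma else delta) b)).
  rewrite pair_big_dep /ore_pi (reindex app_last (onW_bij _ app_bij)) /=.
  apply: eq_big => [[c w]|[c w] _]; last exact: word_comp_rcons.
  by rewrite /= -cats1 count_cat /= addn0.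
rewrite big_bool /=.
congr (_ + _); last by apply: eq_bigl => w; rewrite addn0.
case: i => [|i]; first by apply: big_pred0 => w; rewrite addn1.
by apply: eq_bigl => w; rewrite addn1 eqSS.
Qed.

Lemma ore_pi10 b : pi 1 0 b = delta b.
Proof. by rewrite ore_piS ore_pi00 add0r. Qed.

Lemma ore_pi11 b : pi 1 1 b = sigma b.
Proof. by rewrite ore_piS ore_pi00 ore_pi_gt // addr0. Qed.

(** A word containing delta sends [1] to [0], since sigma fixes [1], delta sends
    [1] to [0] and both are additive. *)
Lemma ore_pir1 m i : sigma 1 = 1 -> delta 1 = 0 -> pi m i 1 = 1 *+ (i == m).
Proof.
move=> s1 d1; elim: m i => [|m IH] i.
  by case: i => [|i]; [apply: ore_pi00 | apply: ore_pi_gt].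
by rewrite ore_piS s1 d1 ore_pi0r addr0; case: i.
Qed.

End OrePi.

(** * Generalized polynomials *)

Section GPoly.
Context (R : naRingType) (sigma delta : {additive R -> R}).
Local Notation S := {gpoly R; sigma, delta}.
Local Notation pi := (ore_pi sigma delta).
Local Notation C := (gpolyC sigma delta).
Local Notation X := (gpolyX sigma delta).
Local Notation mon a n := (<< a *g n%N >> : S).
Implicit Types (a b r : R) (m n i : nat) (p q : S).

Let R_ring : nonassoc_ring R := nonassoc_ringP.

Lemma gpoly_ind (P : S -> Prop) :
  (forall p q, P p -> P q -> P (p + q)) -> (forall a n, P (mon a n)) ->
  forall p, P p.
Proof.
move=> PD PU; apply: malg_ind => //.
by rewrite -(monalgU0 0%N); apply: PU.
Qed.

Lemma gpoly_mulDl : left_distributive *%g (@GRing.add S).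
Proof.
move=> p q r.
apply: (sum_msuppD (f := fun m a => \sum_(n <- msupp r) \sum_(i < m.+1)
  << a * pi m i r@_n *g (i + n)%N >>)) => m a b.
rewrite -big_split; apply: eq_bigr => n _; rewrite -big_split.
by apply: eq_bigr => i _ /=; rewrite na_mulDl // monalgUD.
Qed.

Lemma gpoly_mulDr : right_distributive *%g (@GRing.add S).
Proof.
move=> p q r; rewrite -[RHS]big_split; apply: eq_bigr => m _.
apply: (sum_msuppD (f := fun n b => \sum_(i < m.+1)
  << p@_m * pi m i b *g (i + n)%N >>)) => n a b.
rewrite -big_split; apply: eq_bigr => i _ /=.
by rewrite ore_piD na_mulDr // monalgUD.
Qed.

Lemma gpoly_mulUU a m b n :
  mon a m * mon b n = \sum_(i < m.+1) mon (a * pi m i b) (i + n).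
Proof.
rewrite [LHS](sum_msuppU (f := fun m a => \sum_(n' <- msupp (mon b n))
    \sum_(i < m.+1) << a * pi m i (mon b n)@_n' *g (i + n')%N >>)); last first.
  by move=> k; rewrite big1 // => j _; rewrite big1 // => i _;
     rewrite na_mul0r // monalgU0.
apply: (sum_msuppU (f := fun n b => \sum_(i < m.+1)
    << a * pi m i b *g (i + n)%N >>)) => k.
by rewrite big1 // => i _; rewrite ore_pi0r na_mulr0 // monalgU0.
Qed.

Lemma gpoly_mulCU a b n : C a * mon b n = mon (a * b) n.
Proof. by rewrite gpoly_mulUU big_ord1 ore_pi00. Qed.

Lemma gpolyC_mul a b : C a * C b = C (a * b).
Proof. exact: gpoly_mulCU. Qed.

Lemma gpoly_mulXU b n :
  X * mon b n = mon (delta b) n + mon (sigma b) n.+1.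
Proof.
rewrite gpoly_mulUU big_ord_recl big_ord1 /= !na_mul1r //.
by rewrite ore_pi10 ore_pi11.
Qed.

Lemma associator_XCC a b : associator X (C a) (C b) =
  mon (delta a * b + sigma a * delta b - delta (a * b)) 0 +
  mon (sigma a * sigma b - sigma (a * b)) 1.
Proof.
rewrite /associator gpolyC_mul !gpoly_mulXU gpoly_mulDl gpoly_mulUU big_ord1.
rewrite gpoly_mulUU big_ord_recl big_ord1 /= ore_pi00 ore_pi10 ore_pi11.
by rewrite !(monalgUD, monalgUN) addrA opprD addrACA.
Qed.

Hypotheses (sigma1 : sigma 1 = 1) (delta1 : delta 1 = 0).

(** For [n = 0] this is the right identity law on monomials, and for [n = 1] it
    says that right multiplication by [X] shifts the exponents. *)
Lemma gpoly_mulU1 a m n : mon a m * mon 1 n = mon a (m + n).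
Proof.
rewrite gpoly_mulUU big_ord_recr big1 => [|i _] /=.
  by rewrite add0r ore_pir1 // eqxx na_mulr1.
by rewrite ore_pir1 // ltn_eqF // na_mulr0 // monalgU0.
Qed.

Lemma gpoly_ring : nonassoc_ring S.
Proof.
split; [| |exact: gpoly_mulDl|exact: gpoly_mulDr].
  elim/gpoly_ind => [p q IHp IHq|a n]; first by rewrite gpoly_mulDr IHp IHq.
  by rewrite gpoly_mulCU na_mul1r.
elim/gpoly_ind => [p q IHp IHq|a n]; first by rewrite gpoly_mulDl IHp IHq.
by rewrite gpoly_mulU1 addn0.
Qed.

Lemma gpolyX_exp n : X ^+ n = mon 1 n.
Proof.
case: n => [//|n]; elim: n => // n IH.
by rewrite expgSS IH gpoly_mulU1.
Qed.

Lemma gpolyC_subring : is_subring (range C).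
Proof.
split; first by exists 1.
- by move=> _ _ [a _ <-] [b _ <-]; exists (a - b) => //; apply: monalgUB.
- by move=> _ _ [a _ <-] [b _ <-]; exists (a * b); rewrite ?gpolyC_mul.
Qed.

(** The coordinates of [s] in the basis of powers of [X] are its coefficients:
    with coordinates in the range of [C], a combination of powers of [X] is a
    sum of monomials of distinct exponents, from which they can be read off. *)
Lemma gpolyX_basis : powers_basis (range C) X.
Proof.
(* A constant polynomial is recovered from its coefficient at 0. *)
have sumE (r : {malg S[nat]}) : (forall i, range C r@_i) ->
    \sum_(i <- msupp r) r@_i * X ^+ i =
    \sum_(i <- msupp r) << (r@_i)@_0 *g i >>.
  move=> rC; apply: eq_bigr => i _; have [a _ <-] := rC i.
  by rewrite gpolyX_exp gpoly_mulCU na_mulr1 // mcoeffUU.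
move=> s; pose r0 : {malg S[nat]} := \sum_(i <- msupp s) << C s@_i *g i >>.
have r0E i : r0@_i = C s@_i by apply: mcoeff_sumU; apply: monalgU0.
exists r0; split.
  have r0C i : range C r0@_i by exists s@_i.
  split=> //; rewrite sumE //; apply/malgP => k.
  by rewrite (mcoeff_sumU (f := mcoeff 0)) ?mcoeff0 // r0E mcoeffUU.
move=> r [rC def_s]; apply/malgP => k; rewrite r0E def_s sumE //.
rewrite (mcoeff_sumU (f := mcoeff 0)) ?mcoeff0 //.
by have [a _ <-] := rC k; rewrite mcoeffUU.
Qed.

(** Right multiplication by [X] shifts the exponents, and shifting those of the
    right factor of a product shifts those of the product. *)
Lemma associator_X_right p q : associator p q X = 0.
Proof.
elim/gpoly_ind: p => [p p' IHp IHp'|a m].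
  by rewrite (associatorDl gpoly_ring) IHp IHp' addr0.
elim/gpoly_ind: q => [q q' IHq IHq'|b n].
  by rewrite (associatorDm gpoly_ring) IHq IHq' addr0.
rewrite /associator gpoly_mulU1 !gpoly_mulUU (na_mulr_suml gpoly_ring).
apply/eqP; rewrite subr_eq0; apply/eqP; apply: eq_bigr => i _.
by rewrite gpoly_mulU1 addnA.
Qed.

(** On monomials this is the recursion [ore_piS], multiplied by [a] and summed
    over [i] against the powers of [X]. *)
Lemma associator_X_mid p q : associator p X q = 0.
Proof.
elim/gpoly_ind: p => [p p' IHp IHp'|a m].
  by rewrite (associatorDl gpoly_ring) IHp IHp' addr0.
elim/gpoly_ind: q => [q q' IHq IHq'|b n].
  by rewrite (associatorDr gpoly_ring) IHq IHq' addr0.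
rewrite /associator gpoly_mulU1 gpoly_mulXU gpoly_mulDr !gpoly_mulUU addn1.
apply/eqP; rewrite subr_eq0; apply/eqP.
under eq_bigr do rewrite ore_piS na_mulDr // monalgUD.
rewrite big_split [RHS]addrC; congr (_ + _).
  (* The sigma part has no term at i = 0, whence the shift of the index. *)
  rewrite big_ord_recl /= na_mulr0 // monalgU0 [LHS]add0r.
  by apply: eq_bigr => i _; rewrite /= addSnnS.
(* The delta part has no term at i = m + 1. *)
by rewrite big_ord_recr /= ore_pi_gt // na_mulr0 // monalgU0; apply: addr0.
Qed.

Lemma gpoly_Ore : nonassoc_Ore_extension (range C) X.
Proof.
split.
- split; [exact: gpoly_ring | exact: gpolyC_subring].
- exact: gpolyX_basis.
- move=> _ [a _ <-]; exists (C (delta a)), (C (sigma a)).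
  by split; [exists (delta a)|exists (sigma a)|rewrite gpoly_mulXU gpoly_mulU1].
- split; apply: associators_eq0 => p q r _.
  + by move=> _ ->; apply: associator_X_right.
  + by move=> -> _; apply: associator_X_mid.
Qed.

Lemma gpolyC_commX a : C a * X = X * C a -> fixed_kernel sigma delta a.
Proof.
rewrite gpoly_mulU1 gpoly_mulXU => /malgP eqX.
by split; [have := eqX 1%N | have := eqX 0%N];
  rewrite mcoeffD !mcoeffU /= ?add0r ?addr0.
Qed.

Lemma gpoly_strong_Ore : fixed_point_hom_kernel_derivation sigma delta ->
  strong_nonassoc_Ore_extension (range C) X.
Proof.
case=> _ _ lin; split; first exact: gpoly_Ore.
case: lin => -[sl dl]; [left|right]; apply: associators_eq0.
- move=> _ _ _ -> [r _ <-] [[a _ <-] /gpolyC_commX ka].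
  rewrite associator_XCC sl // dl //; have [-> ->] := ka.
  by rewrite na_mulr0 // addr0 !subrr !monalgU0 addr0.
- move=> _ _ _ -> [[a _ <-] /gpolyC_commX ka] [r _ <-].
  rewrite associator_XCC sl // dl //; have [-> ->] := ka.
  by rewrite na_mul0r // add0r !subrr !monalgU0 addr0.
Qed.

End GPoly.

Theorem proposition14 (R : naRingType) (sigma delta : {additive R -> R})
    (sigma1 : sigma 1%g = 1%g) (delta1 : delta 1%g = 0%R) :
  @nonassoc_Ore_extension {gpoly R; sigma, delta}
    (range (gpolyC sigma delta)) (gpolyX sigma delta) /\
  (fixed_point_hom_kernel_derivation sigma delta ->
   @strong_nonassoc_Ore_extension {gpoly R; sigma, delta}
     (range (gpolyC sigma delta)) (gpolyX sigma delta)).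
Proof.
by split; [apply: gpoly_Ore | apply: gpoly_strong_Ore].
Qed.
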